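(* For every pattern $\sigma\in S_m$, $$\rho_{\sigma}\geq 1-\frac{1}{m!}-O\left(\frac{m-1}{(m!)^2}\right),$$ where the $O$-term refers to $m\to\infty$ and is uniform in $\sigma$ (i.e. there is a constant $C>0$ such that for all $m$ and all $\sigma\in S_m$, $\rho_\sigma\ge 1-\frac1{m!}-C\frac{m-1}{(m!)^2}$).
   Context: $S_n$ denotes the set of permutations of $\{1,\dots,n\}$. For distinct integers $x_1,\dots,x_k$, $\mathrm{st}(x_1,\dots,x_k)\in S_k$ is the permutation obtained by replacing each entry by its rank among $x_1,\dots,x_k$. A permutation $\pi\in S_n$ contains $\sigma\in S_m$ as a consecutive pattern if $\mathrm{st}(\pi_{i+1},\dots,\pi_{i+m})=\sigma$ for some $0\le i\le n-m$; otherwise it is $\sigma$-avoiding. $\alpha_n(\sigma)$ is the number of $\sigma$-avoiding permutations in $S_n$, and $\rho_\sigma=\lim_{n\to\infty}(\alpha_n(\sigma)/n!)^{1/n}$ (this limit is known to exist). *)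

(* Defs.v *)
From mathcomp Require Import all_boot all_order all_algebra.
From mathcomp Require Import perm.
From mathcomp Require Import all_classical all_reals all_analysis.

Set Implicit Arguments.
Unset Strict Implicit.
Unset Printing Implicit Defensive.

Import Order.TTheory GRing.Theory Num.Theory.
Import numFieldNormedType.Exports.

(* Permutations of {1, ..., n} are elements of 'S_n, i.e. permutations of      *)
(* {0, ..., n - 1}; positions and ranks are accordingly numbered from 0.       *)

Section Standardization.
Variables (k : nat) (x : 'I_k -> nat).

Definition st_below (i : 'I_k) : {set 'I_k} := [set j | x j < x i].

Lemma st_below_lt (i : 'I_k) : #|st_below i| < k.
Proof.
rewrite -[ltnRHS]card_ord -cardsT; apply: proper_card.
by apply/properP; split; [exact: finset.subsetT | exists i; rewrite !inE ?ltnn].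
Qed.

Definition st_rank (i : 'I_k) : 'I_k := Ordinal (st_below_lt i).

Lemma st_rank_inj : injective x -> injective st_rank.
Proof.
have mono i j : x i < x j -> st_rank i < st_rank j.
  move=> ltij /=; apply: proper_card; apply/properP; split.
    by apply/fintype.subsetP => l; rewrite !inE => /ltn_trans; apply.
  by exists i; rewrite !inE ?ltnn.
move=> injx i j eqij; apply: injx.
by case: (ltngtP (x i) (x j)) => // /mono; rewrite eqij ltnn.
Qed.

Definition st (injx : injective x) : 'S_k := perm (st_rank_inj injx).

End Standardization.

Section ConsecutivePatterns.
Variables (n m : nat) (pi : 'S_n).

(* The type 'I_(n.+1 - m) is {i | i + m <= n}, and is empty when n < m.        *)
Lemma window_lt (i : 'I_(n.+1 - m)) (j : 'I_m) : i + j < n.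
Proof.
have := ltn_ord i; rewrite ltn_subRL addnC ltnS; apply: leq_trans.
by rewrite ltn_add2l.
Qed.

Definition window (i : 'I_(n.+1 - m)) (j : 'I_m) : nat :=
  pi (Ordinal (window_lt i j)).

Lemma window_inj (i : 'I_(n.+1 - m)) : injective (window i).
Proof.
by move=> j l /val_inj/perm_inj/(congr1 val)/addnI/val_inj.
Qed.

Definition contains (sigma : 'S_m) : bool :=
  [exists i : 'I_(n.+1 - m), st (@window_inj i) == sigma].

Definition avoids (sigma : 'S_m) : bool := ~~ contains sigma.

End ConsecutivePatterns.

Definition alpha (n m : nat) (sigma : 'S_m) : nat :=
  #|[set pi : 'S_n | avoids pi sigma]|.

Local Open Scope classical_set_scope.
Local Open Scope ring_scope.

Definition rho (R : realType) (m : nat) (sigma : 'S_m) : R :=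
  lim ((fun n : nat => ((alpha n sigma)%:R / n`!%:R) `^ n%:R^-1) @ \oo).

(* Main.v *)
(* Let a_n = alpha_n(sigma) / n!. A permutation of size n + k is determined by *)
(* the set of its first n values and the standardizations of its prefix and of *)
(* its suffix, and these are arbitrary. Hence a_(n+k) <= a_n a_k, so that the  *)
(* limit of a_n^(1/n) exists (Fekete), and a_(n+1) >= a_n - a_(n+1-m) / m!.    *)
(* As in the one-sided Lovasz local lemma, if 1/m! <= x (1-x)^(m-1) the latter *)
(* gives a_(n+1) >= (1-x) a_n by induction, whence rho >= 1 - x.               *)

Require Import Defs.
From mathcomp Require Import all_boot all_order all_algebra.
From mathcomp Require Import perm.
From mathcomp Require Import all_classical all_reals all_analysis.
From mathcomp Require Import ring lra.

Import Order.TTheory GRing.Theory Num.Theory.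
Import numFieldNormedType.Exports.
Local Open Scope ring_scope.

Set Implicit Arguments.
Unset Strict Implicit.

(** Let a_n be the probability that a random permutation of size n avoids sigma. The patterns of a
    prefix and of the complementary suffix are independent and uniform ([card_st_windows]). This
    makes a_n submultiplicative, so a_n^(1/n) converges ([cvg_submul_root]), and gives a_(n+1) >=
    a_n - a_(n+1-m) / m! ([density_recursion]). The recursion forces a_n >= (1-x)^n whenever 1/m! <=
    x (1-x)^(m-1) ([recursion_geometric]). For m >= 4, Bernoulli's inequality shows that x = 1/m! +
    15 (m-1)/m!^2 qualifies; for smaller m the claimed bound is nonpositive. *)

Section Combinatorics.
Local Open Scope nat_scope.

(** * Standardization and order isomorphism *)

Lemma st_lt k (x : 'I_k -> nat) (injx : injective x) (i j : 'I_k) :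
  (st injx i < st injx j) = (x i < x j).
Proof.
have mono i' j' : x i' < x j' -> st injx i' < st injx j'.
  move=> ltij; rewrite !permE /=; apply: proper_card; apply/properP; split.
    by apply/fintype.subsetP => l; rewrite !inE => /ltn_trans; apply.
  by exists i'; rewrite !inE ?ltnn.
apply/idP/idP; last exact: mono.
case: (ltngtP (x i) (x j)) => // [/mono /ltnW|/injx ->]; last by rewrite ltnn.
by rewrite leqNgt => /negbTE ->.
Qed.

Lemma eq_st k (x y : 'I_k -> nat) (injx : injective x) (injy : injective y) :
  (forall i j, (x i < x j) = (y i < y j)) -> st injx = st injy.
Proof.
move=> xy; apply/permP => i; apply: val_inj; rewrite !permE /=.
by apply: eq_card => j; rewrite !inE xy.
Qed.

(** An element of a finite set is determined by its rank there, and the rank of [x i] in the common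
    image [A] depends only on the relative order of the values of [x]. *)
Lemma order_iso_eq k N (x y : 'I_k -> 'I_N) :
    injective x -> injective y -> x @: [set: 'I_k] = y @: [set: 'I_k] ->
    (forall i j, (x i < x j) = (y i < y j)) -> x =1 y.
Proof.
move=> injx injy eqim iso.
pose A := x @: [set: 'I_k].
have below (z : 'I_k -> 'I_N) i : injective z -> z @: [set: 'I_k] = A ->
    #|[set j | z j < z i]| = #|[set a in A | a < z i]|.
  move=> injz zA; rewrite -(card_imset _ injz); apply: eq_card => a.
  apply/imsetP/idP => [[j]|]; rewrite !inE.
    by move=> lt ->; rewrite -zA imset_f ?inE.
  by rewrite -zA => /andP[/imsetP[j _ ->] lt]; exists j; rewrite ?inE.
have main i : #|[set a in A | a < x i]| = #|[set a in A | a < y i]|.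
  rewrite -(below x) // -(below y) //; apply: eq_card => j.
  by rewrite !inE iso.
have strict (a b : 'I_N) : a \in A -> a < b ->
    #|[set c in A | c < a]| < #|[set c in A | c < b]|.
  move=> aA ab; apply: proper_card; apply/properP; split.
    apply/fintype.subsetP => l; rewrite !inE => /andP[-> /=] /ltn_trans; exact.
  by exists a; rewrite !inE ?aA ?ab ?ltnn ?andbF.
move=> i; apply: val_inj => /=.
case: (ltngtP (x i) (y i)) => // /strict H.
  by move: H; rewrite main ltnn imset_f ?inE // => /(_ isT).
by move: H; rewrite main ltnn /A eqim imset_f ?inE // => /(_ isT).
Qed.

Definition st_window n m (pi : 'S_n) (i : 'I_(n.+1 - m)) : 'S_m :=
  st (@window_inj n m pi i).

Lemma st_window_st_window N n m (pi : 'S_N) (i : 'I_(N.+1 - n))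
    (j : 'I_(n.+1 - m)) (l : 'I_(N.+1 - m)) :
  l = i + j :> nat ->
  st_window (st_window pi i) j = st_window pi l.
Proof.
move=> lE; apply: eq_st => a b; rewrite /window st_lt /window.
by congr (pi _ < pi _); apply: val_inj => /=; rewrite lE addnA.
Qed.

(** * Independence of prefix and suffix patterns *)

Section Split.
Context {N n k : nat} {i : 'I_(N.+1 - n)} {j : 'I_(N.+1 - k)}.
Hypotheses (i0 : i = 0 :> nat) (jn : j = n :> nat) (nkN : n + k = N).

Definition prefix_image (pi : 'S_N) : {set 'I_N} :=
  [set pi (Ordinal (window_lt i a)) | a in [set: 'I_n]].

Lemma suffix_image (pi : 'S_N) :
  [set pi (Ordinal (window_lt j a)) | a in [set: 'I_k]] = ~: prefix_image pi.
Proof.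
apply/setP => b; rewrite inE.
have [a ->] : exists a, b = pi a by exists (pi^-1 b)%g; rewrite permKV.
apply/imsetP/negP.
  move=> [c _ /perm_inj ac] /imsetP[d _ /perm_inj ad].
  have := ltn_ord d; move: ad; rewrite ac => /(congr1 val) /=.
  by rewrite i0 jn add0n => <-; rewrite ltnNge leq_addr.
move=> H; case: (ltnP a n) => an.
  case: H; apply/imsetP; exists (Ordinal an) => //; congr (pi _); apply: val_inj.
  by rewrite /= i0.
have ak : a - n < k by rewrite ltn_subLR // nkN.
exists (Ordinal ak) => //; congr (pi _); apply: val_inj.
by rewrite /= jn subnKC.
Qed.

Definition split_perm (pi : 'S_N) :=
  (prefix_image pi, (st_window pi i, st_window pi j)).

(** The prefix values determine the suffix values by complement; each half is then recovered from
    its value set and its pattern by [order_iso_eq]. *)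
Lemma split_perm_inj : injective split_perm.
Proof.
move=> p q [eqA eqi eqj].
have inj M (l : 'I_(N.+1 - M)) (r : 'S_N) :
    injective (fun a : 'I_M => r (Ordinal (window_lt l a))).
  by move=> a b /(congr1 val); exact: window_inj.
have ei : (fun a => p (Ordinal (window_lt i a))) =1
          (fun a => q (Ordinal (window_lt i a))).
  apply: order_iso_eq; [exact: inj|exact: inj|exact: eqA|] => a b.
  have := congr1 (fun s : 'S_n => s a < s b) eqi.
  by rewrite /st_window !st_lt.
have ej : (fun a => p (Ordinal (window_lt j a))) =1
          (fun a => q (Ordinal (window_lt j a))).
  apply: order_iso_eq; [exact: inj|exact: inj| |] => [|a b].
    by rewrite !suffix_image eqA.
  have := congr1 (fun s : 'S_k => s a < s b) eqj.
  by rewrite /st_window !st_lt.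
apply/permP => a; case: (ltnP a n) => an.
  have := ei (Ordinal an); set b := Ordinal (window_lt i _).
  by have -> : b = a by apply: val_inj; rewrite /= i0.
have ak : a - n < k by rewrite ltn_subLR // nkN.
have := ej (Ordinal ak); set b := Ordinal (window_lt j _).
by have -> : b = a by apply: val_inj; rewrite /= jn subnKC.
Qed.

Lemma card_prefix_image (pi : 'S_N) : #|prefix_image pi| = n.
Proof.
rewrite card_imset ?cardsT ?card_ord // => a b /(congr1 val).
exact: window_inj.
Qed.

Lemma card_st_windows (P : {set 'S_n}) (Q : {set 'S_k}) :
  #|[set pi : 'S_N | (st_window pi i \in P) && (st_window pi j \in Q)]| =
  'C(N, n) * (#|P| * #|Q|).
Proof.
pose D (P : {set 'S_n}) (Q : {set 'S_k}) :=
  finset.setX [set A : {set 'I_N} | #|A| == n] (finset.setX P Q).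
have cardD P' Q' : #|D P' Q'| = 'C(N, n) * (#|P'| * #|Q'|).
  by rewrite !cardsX card_draws card_ord.
(* [split_perm] is injective into a set of C(N, n) n! k! = N! elements, hence *)
(* onto that set.                                                            *)
have onto : split_perm @: [set: 'S_N] = D [set: 'S_n] [set: 'S_k].
  apply/eqP; rewrite eqEcard; apply/andP; split.
    apply/fintype.subsetP => _ /imsetP[p _ ->].
    by rewrite !inE /= card_prefix_image eqxx.
  rewrite cardD card_imset; last exact: split_perm_inj.
  rewrite !cardsT !card_Sn -nkN.
  by rewrite -(bin_fact (leq_addr k n)) addKn.
rewrite -cardD -(card_imset _ split_perm_inj); apply: eq_card => -[A [s t]].
apply/imsetP/idP.
  move=> [p]; rewrite !inE => /andP[pP pQ] ->.
  by rewrite /= card_prefix_image eqxx pP.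
rewrite !inE /= => /and3P[cA sP tQ].
have : (A, (s, t)) \in D [set: 'S_n] [set: 'S_k] by rewrite !inE /= cA.
rewrite -onto => /imsetP[p _ [-> es et]]; exists p; last by rewrite es et.
by rewrite inE -es -et sP.
Qed.

End Split.

(** * Counting inequalities for avoiders *)

Lemma containsP n m (pi : 'S_n) (sigma : 'S_m) :
  reflect (exists i, st_window pi i = sigma) (contains pi sigma).
Proof.
by apply: (iffP existsP) => -[i]; [move/eqP => <- | move=> <-]; exists i;
  rewrite ?eqxx.
Qed.

Lemma avoids_st_window N n m (sigma : 'S_m) (pi : 'S_N) (i : 'I_(N.+1 - n)) :
  avoids pi sigma -> avoids (st_window pi i) sigma.
Proof.
apply: contra => /containsP[j js]; apply/containsP.
have lt : i + j < N.+1 - m.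
  have := ltn_ord i; have := ltn_ord j; rewrite !ltn_subRL !ltnS => H1 H2.
  by rewrite addnC -addnA (leq_trans _ H2) // addnC leq_add2r addnC.
exists (Ordinal lt).
by rewrite -js (@st_window_st_window _ _ _ pi i j (Ordinal lt)).
Qed.

Lemma first_window_lt n N : n <= N -> 0 < N.+1 - n.
Proof. by rewrite subn_gt0. Qed.

(** Both the prefix and the suffix of an avoider avoid sigma; [card_st_windows] counts all
    permutations with this property. *)
Lemma alpha_submul n k m (sigma : 'S_m) :
  alpha (n + k) sigma <= 'C(n + k, n) * (alpha n sigma * alpha k sigma).
Proof.
have lt : n < (n + k).+1 - k by rewrite ltn_subRL addnC ltnS.
pose i := Ordinal (first_window_lt (leq_addr k n)).
pose j := Ordinal lt.
rewrite -(@card_st_windows (n + k) n k i j) //; apply: subset_leq_card.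
by apply/fintype.subsetP => pi; rewrite !inE => H; rewrite !avoids_st_window.
Qed.

(* If the prefix of length n of a permutation of size n + 1 avoids sigma, an  *)
(* occurrence of sigma can only be in the last window, and that window is     *)
(* disjoint from the prefix of length n + 1 - m.                              *)
Lemma alpha_recursion n m (sigma : 'S_m) : 0 < m <= n.+1 ->
  n.+1 * alpha n sigma <=
  alpha n.+1 sigma + 'C(n.+1, m) * alpha (n.+1 - m) sigma.
Proof.
move=> /andP[m0 mn].
have lt1 : n < n.+2 - 1 by rewrite subn1.
have ltm : n.+1 - m < n.+2 - m by rewrite (subSn mn).
pose i := Ordinal (first_window_lt (leqnSn n)).
pose i' := Ordinal (first_window_lt (leq_subr m n.+1)).
pose j := Ordinal lt1; pose j' := Ordinal ltm.
(* The left-hand side counts the permutations of size n + 1 whose first n entries avoid sigma; the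
   last entry is unconstrained. *)
have := @card_st_windows n.+1 n 1 i j erefl erefl (addn1 n)
  [set p | avoids p sigma] [set: _].
rewrite binSn cardsT card_Sn muln1 => <-.
(* The product on the right counts those whose last window is an occurrence of sigma and whose
   remaining prefix avoids sigma. *)
have := @card_st_windows n.+1 (n.+1 - m) m i' j' erefl erefl (subnK mn)
  [set p | avoids p sigma] [set sigma]%SET.
rewrite cards1 muln1 bin_sub // => <-.
apply: leq_trans (leq_card_setU _ _); apply: subset_leq_card.
apply/fintype.subsetP => pi; rewrite !inE andbT => pi_av.
have [//|/negPn/containsP[l ls]] := boolP (avoids pi sigma); rewrite /=.
have [lj|lj] := eqVneq (l : nat) (n.+1 - m).
  have -> : j' = l by apply: val_inj.
  rewrite ls eqxx andbT.
  have mn' : n.+1 - m <= n by rewrite leq_subLR -add1n leq_add2r.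
  rewrite -(@st_window_st_window _ _ _ pi i (Ordinal (first_window_lt mn'))) //.
  exact: avoids_st_window.
have lt : l < n.+1 - m.
  by rewrite ltn_neqAle lj -ltnS -(subSn mn) ltn_ord.
case/negP: pi_av; apply/containsP; exists (Ordinal lt).
by rewrite (@st_window_st_window _ _ _ pi i (Ordinal lt) l).
Qed.


Lemma alpha_le_fact n m (sigma : 'S_m) : alpha n sigma <= n`!.
Proof. by rewrite -card_Sn max_card. Qed.

Lemma alpha_small n m (sigma : 'S_m) : n < m -> alpha n sigma = n`!.
Proof.
move=> nm; rewrite -card_Sn -cardsT; apply: eq_card => pi; rewrite !inE.
by apply/existsP => -[i]; have := ltn_ord i; rewrite ltn_subRL addnC ltnS leqNgt
  (leq_trans nm) ?leq_addl.
Qed.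

End Combinatorics.

(** * Submultiplicative sequences and the local-lemma recursion *)

Section Analysis.
Context {R : realType}.
Implicit Types (u : nat -> R) (x y z : R).

Lemma powR_invnK x n : 0 <= x -> (0 < n)%N -> (x `^ n%:R^-1) ^+ n = x.
Proof.
move=> x0 n0; rewrite -powR_mulrn ?powR_ge0 // -powRrM mulVf ?powRr1 //.
by rewrite pnatr_eq0 -lt0n.
Qed.

Lemma exprK_powR_invn x n : 0 <= x -> (0 < n)%N -> (x ^+ n) `^ n%:R^-1 = x.
Proof.
move=> x0 n0; rewrite -powR_mulrn // -powRrM mulfV ?powRr1 //.
by rewrite pnatr_eq0 -lt0n.
Qed.

(** Writing n = qN + r with r < N gives u n <= (u N)^q <= y^(qN), and c = min(1, y)^N is at most the
    missing factor y^r. *)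
Lemma submul_geometric u N y : (0 < N)%N -> 0 < y ->
    (forall n, 0 <= u n <= 1) -> (forall n k, u (n + k)%N <= u n * u k) ->
    u N <= y ^+ N ->
  exists2 c, 0 < c & forall n, c * u n <= y ^+ n.
Proof.
move=> N0 y0 u01 usub uN.
have u0 n : 0 <= u n by have /andP[] := u01 n.
have u1 n : u n <= 1 by have /andP[] := u01 n.
have uq q : u (q * N)%N <= (y ^+ N) ^+ q.
  elim: q => [|q IH]; first by rewrite mul0n expr0.
  by rewrite mulSn exprS (le_trans (usub _ _)) // ler_pM.
have w0 : 0 < Num.min 1 y by rewrite lt_min ltr01.
exists (Num.min 1 y ^+ N); first exact: exprn_gt0.
move=> n; rewrite [in u n](divn_eq n N) [in leRHS](divn_eq n N) exprD mulrC.
apply: ler_pM; rewrite ?exprn_ge0 ?(ltW w0) //.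
  rewrite (le_trans (usub _ _)) // mulnC exprM -[leRHS]mulr1 mulnC.
  by rewrite ler_pM.
apply: (@le_trans _ _ (Num.min 1 y ^+ (n %% N))).
  by rewrite ler_wiXn2l ?(ltW w0) ?ge_min ?lexx // ltnW // ltn_pmod.
by rewrite lerXn2r ?nnegrE ?(ltW w0) ?(ltW y0) // ge_min lexx orbT.
Qed.

(** Fekete's lemma, with limit the infimum of the roots over n > 0. It is needed because [rho] is a
    [lim], which can be bounded through its terms only once convergence is known. *)
Lemma cvg_submul_root u :
    (forall n, 0 <= u n <= 1) -> (forall n k, u (n + k)%N <= u n * u k) ->
  cvg ((fun n => u n `^ n%:R^-1) @ \oo)%classic.
Proof.
move=> u01 usub.
have u0 n : 0 <= u n by have /andP[] := u01 n.
pose r n := u n `^ n%:R^-1.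
pose S := (r @` [set n | (0 < n)%N])%classic.
have lbS : has_inf S.
  split; first by exists (r 1%N), 1%N.
  by exists 0 => _ [n _ <-]; exact: powR_ge0.
pose L := inf S.
have L0 : 0 <= L.
  apply: lb_le_inf; first by case: lbS.
  by move=> _ [n _ <-]; exact: powR_ge0.
apply/cvg_ex; exists L; apply/cvgrPdist_le => e e0.
(* Aiming at L + e/2 leaves room to absorb the constant c: the ratio ((L + e/2) / (L + e))^n tends
   to 0. *)
have e20 : 0 < e / 2 by rewrite divr_gt0.
have [_ [N /= N0 <-] rN] := inf_adherent e20 lbS.
have y0 : 0 < L + e / 2 by rewrite ltr_wpDl.
have [|c c0 cu] := submul_geometric N0 y0 u01 usub.
  rewrite -(powR_invnK (u0 N) N0) lerXn2r ?nnegrE ?powR_ge0 ?(ltW y0) //.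
  exact: ltW.
have z0 : 0 < L + e by rewrite ltr_wpDl.
have q1 : `|(L + e / 2) / (L + e)| < 1.
  rewrite ger0_norm ?divr_ge0 ?ltW // ltr_pdivrMr // mul1r ltrD2l.
  by rewrite gtr_pMr // invf_lt1 // ltr1n.
near=> n.
have n0 : (0 < n)%N by near: n; exact: nbhs_infty_gt.
have Lr : L <= r n by apply: ge_inf; [case: lbS | exists n].
rewrite ler0_norm ?subr_le0 // opprB lerBlDl.
rewrite -[leRHS](exprK_powR_invn (ltW z0) n0).
apply: ge0_ler_powR; rewrite ?invr_ge0 ?nnegrE ?exprn_ge0 ?(ltW z0) //.
rewrite -(ler_pM2l c0) (le_trans (cu n)) // -ler_pdivrMr ?exprn_gt0 //.
rewrite -expr_div_n (le_trans (ler_norm _)) //.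
near: n; exact: (cvgr0_norm_le _ (cvg_expr q1) _ c0).
Unshelve. all: by end_near. Qed.

(** Strong induction on u (n+1) >= (1-x) u n: the m - 1 preceding steps give (1-x)^(m-1) u (n+1-m)
    <= u n, so the subtracted term is at most x u n. *)
Lemma recursion_geometric u m p x :
    (0 < m)%N -> 0 <= x <= 1 -> p <= x * (1 - x) ^+ m.-1 ->
    (forall n, 0 <= u n <= 1) ->
    (forall n, (n < m)%N -> u n = 1) ->
    (forall n, (m <= n.+1)%N -> u n - p * u (n.+1 - m)%N <= u n.+1) ->
  forall n, (1 - x) ^+ n <= u n.
Proof.
move=> m0 /andP[x0 x1] px u01 u1 urec.
have u0 n : 0 <= u n by have /andP[] := u01 n.
have step n : (1 - x) * u n <= u n.+1.
  elim/ltn_ind: n => n IH.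
  have [nm|mn] := ltnP n.+1 m.
    rewrite !u1 //; [by rewrite mulr1 lerBlDr lerDl | exact: ltnW].
  have back k : (k <= n)%N -> (1 - x) ^+ k * u (n - k)%N <= u n.
    elim: k => [|k IHk] kn; first by rewrite mul1r subn0.
    rewrite (le_trans _ (IHk (ltnW kn))) // exprSr -mulrA.
    rewrite ler_wpM2l ?exprn_ge0 ?subr_ge0 //.
    have -> : (n - k = (n - k.+1).+1)%N by rewrite subnSK.
    by apply: IH; rewrite ltn_subrL (leq_trans _ kn).
  have m1n : (m.-1 <= n)%N by rewrite -ltnS prednK.
  rewrite (le_trans _ (urec n mn)) // mulrBl mul1r lerB //.
  have -> : (n.+1 - m = n - m.-1)%N by rewrite -{1}(prednK m0) subSS.
  rewrite (le_trans (ler_wpM2r (u0 _) px)) // -mulrA.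
  by rewrite ler_wpM2l // back.
elim=> [|n IH]; first by rewrite u1.
by rewrite exprS (le_trans _ (step n)) // ler_wpM2l // subr_ge0.
Qed.

Lemma bernoulli_ineq x n : 0 <= x <= 1 -> 1 - n%:R * x <= (1 - x) ^+ n.
Proof.
move=> /andP[x0 x1]; elim: n => [|n IH]; first by rewrite mul0r subr0.
rewrite exprS (le_trans _ (ler_wpM2l _ IH)) ?subr_ge0 //.
have : 0 <= n%:R * x * x by rewrite !mulr_ge0.
by rewrite -natr1; lra.
Qed.

End Analysis.

(** * Avoidance probabilities and lower bounds for [rho] *)

Section Density.
Context {R : realType} {m : nat}.
Variable sigma : 'S_m.

Definition density n : R := (alpha n sigma)%:R / n`!%:R.

Lemma fact_gt0r n : 0 < n`!%:R :> R.
Proof. by rewrite ltr0n fact_gt0. Qed.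

Lemma natr_bin n k : 'C(n + k, n)%:R = (n + k)`!%:R / (n`!%:R * k`!%:R) :> R.
Proof.
by rewrite -(bin_fact (leq_addr k n)) addKn -natrM natrM mulfK.
Qed.

Lemma density_bounds n : 0 <= density n <= 1.
Proof.
rewrite divr_ge0 ?ler0n //= ler_pdivrMr ?fact_gt0r // mul1r ler_nat.
exact: alpha_le_fact.
Qed.

Lemma density_small n : (n < m)%N -> density n = 1.
Proof.
by move=> nm; rewrite /density alpha_small // divff // gt_eqF ?fact_gt0r.
Qed.

Lemma density_submul n k : density (n + k)%N <= density n * density k.
Proof.
rewrite /density ler_pdivrMr ?fact_gt0r //.
have := alpha_submul n k sigma.
rewrite -(ler_nat R) !natrM natr_bin => /le_trans; apply.
by rewrite le_eqVlt; apply/orP; left; apply/eqP; field; rewrite !gt_eqF ?fact_gt0r.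
Qed.

Lemma density_recursion n : (0 < m)%N -> (m <= n.+1)%N ->
  density n - m`!%:R^-1 * density (n.+1 - m)%N <= density n.+1.
Proof.
move=> m0 mn; have := @alpha_recursion n m sigma.
rewrite m0 mn => /(_ isT); rewrite -(ler_nat R) natrD !natrM.
have -> : 'C(n.+1, m)%:R = n.+1`!%:R / (m`!%:R * (n.+1 - m)`!%:R) :> R.
  by rewrite -[in 'C(_, _)](subnKC mn) natr_bin subnKC.
rewrite /density lerBlDr => H.
rewrite -(ler_pM2r (fact_gt0r n.+1)) mulrDl divfK ?gt_eqF ?fact_gt0r //.
apply: le_trans (le_trans H _); rewrite le_eqVlt; apply/orP; left; apply/eqP.
  by rewrite factS natrM; field; rewrite gt_eqF ?fact_gt0r.
congr (_ + _); field; rewrite !gt_eqF ?fact_gt0r //.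
Qed.

Lemma rho_ge x :
  (forall n, (0 < n)%N -> x <= density n `^ n%:R^-1) -> x <= rho R sigma.
Proof.
move=> H; apply: limr_ge.
  exact: (cvg_submul_root density_bounds density_submul).
by near=> n; apply: H; near: n; exact: nbhs_infty_gt.
Unshelve. all: by end_near. Qed.

Lemma rho_ge0 : 0 <= rho R sigma.
Proof. by apply: rho_ge => n _; exact: powR_ge0. Qed.

Lemma rho_ge_onem x : (0 < m)%N -> 0 <= x <= 1 ->
  m`!%:R^-1 <= x * (1 - x) ^+ m.-1 -> 1 - x <= rho R sigma.
Proof.
move=> m0 x01 px; have x1 : 0 <= 1 - x by have /andP[_] := x01; rewrite subr_ge0.
apply: rho_ge => n n0; rewrite -[leLHS](exprK_powR_invn x1 n0).
apply: ge0_ler_powR; rewrite ?invr_ge0 ?nnegrE ?exprn_ge0 //.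
  by have /andP[] := density_bounds n.
apply: (recursion_geometric m0 x01 px density_bounds density_small) => k.
exact: density_recursion.
Qed.

End Density.

(** * Choice of x and the final estimate *)

Lemma fact_ge_8predn m : (3 < m)%N -> (8 * m.-1 <= m`!)%N.
Proof.
(* In terms of the original m, m! = (m-1) m (m-2)! with m >= 4 and (m-2)! >= 2. *)
case: m => [|[|m]] // m2; rewrite !factS mulnCA mulnC leq_mul2l /=.
by rewrite (@leq_mul 4 2) // (leq_trans _ (fact_geq m)).
Qed.

Theorem theorem2 (R : realType) :
  exists C : R, 0 < C /\
    forall (m : nat) (sigma : 'S_m), (0 < m)%N ->
      1 - 1 / m`!%:R - C * ((m%:R - 1) / m`!%:R ^+ 2) <= rho R sigma.
Proof.
(* 15 makes the bound nonpositive for m = 2, 3, and (1 - x)^(m-1) x >= 1/m!   *)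
(* for x = 1/m! + 15 (m-1)/m!^2 as soon as (m-1)/m! <= 1/8, i.e. m >= 4.      *)
exists 15; split=> [//|m sigma m0].
have [m3|m3] := leqP m 3.
  (* The bound is 0 for m = 1, and exactly 0 for m = 3, so no constant below 15 would do here. *)
  apply: le_trans (rho_ge0 sigma).
  case: m m0 m3 {sigma} => [//|[|[|[|//]]]] _ _; rewrite /factorial /=; lra.
set p := m`!%:R^-1 : R; set k := m.-1%:R : R.
have -> : m%:R - 1 = k by rewrite /k -[in LHS](prednK m0) -natr1 addrK.
have p0 : 0 < p by rewrite invr_gt0 fact_gt0r.
have k0 : 0 <= k by rewrite ler0n.
have t8 : k * p <= 1 / 8.
  rewrite ler_pdivrMr ?fact_gt0r // mulrAC ler_pdivlMr // mul1r mulrC -natrM.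
  rewrite ler_nat; exact: fact_ge_8predn.
have k1 : 1 <= k by rewrite ler1n -ltnS prednK // (leq_trans _ m3).
have -> : 1 - 1 / m`!%:R - 15 * (k / m`!%:R ^+ 2) = 1 - (p + 15 * (k * p ^+ 2)).
  by rewrite /p exprVn; ring.
have t0 : 0 <= k * p by rewrite mulr_ge0 // ltW.
have pp : p <= k * p by rewrite ler_peMl // ltW.
(* Since p <= kp <= 1/8, x is at most 1/8 + 15/64. *)
have x01 : 0 <= p + 15 * (k * p ^+ 2) <= 1.
  by apply/andP; split; nra.
apply: rho_ge_onem => //.
apply: le_trans (ler_wpM2l _ (bernoulli_ineq m.-1 x01)); last by case/andP: x01.
rewrite -/p -/k.
set t := k * p in t8 t0 pp.
(* Here x = p (1 + 15t) and kx = t (1 + 15t); the last factor is positive for 0 <= t <= 1/8. *)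
have -> : (p + 15 * (k * p ^+ 2)) * (1 - k * (p + 15 * (k * p ^+ 2))) =
  p + p * t * (14 - 30 * t - 225 * t ^+ 2) by rewrite /t; ring.
rewrite lerDl mulr_ge0 ?(mulr_ge0 (ltW p0)) //; nra.
Qed.
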